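(* Let $\mathbf t=t_0t_1t_2\cdots=01101001\cdots$ be the Thue--Morse word, the fixed point of $0\mapsto01$, $1\mapsto10$. For $i\ge0$ and $m,n\ge1$ let $A(i,m,n)=(t_{i+k+\ell})_{0\le k<m,0\le\ell<n}$ and let $|A(i,m,n)|_1$ be the number of entries equal to $1$. Then: (a) every such rectangle satisfies $\big|2|A(i,m,n)|_1-mn\big|\le4$; (b) if there is $i$ with $2|A(i,m,n)|_1-mn=c$, then there is $j$ with $2|A(j,m,n)|_1-mn=-c$; (c) for all $m,n\ge1$, the balance of the $m\times n$ rectangles is $1$, $2$, $3$, or $4$.
   Context: The balance of the $m\times n$ rectangles is $\max_{i,j\ge0}\big||A(i,m,n)|_1-|A(j,m,n)|_1\big|$ (for a binary word this equals the corresponding maximum for the letter $0$). *)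

(* Defs.v *)
(* Letters are booleans (false = 0, true = 1), infinite binary
   words are functions nat -> bool. *)
From mathcomp Require Import all_boot all_order all_algebra.
From mathcomp Require Import zify.

Set Implicit Arguments.
Unset Strict Implicit.
Unset Printing Implicit Defensive.

(* The morphism 0 |-> 01, 1 |-> 10. *)
Definition tm_letter (a : bool) : seq bool :=
  if a then [:: true; false] else [:: false; true].

Definition tm_morphism (s : seq bool) : seq bool := flatten (map tm_letter s).

(* The images of the first n+1 letters already contain the letter of index n
   of the image, since the morphism is non-erasing. *)
Definition tm_morphism_inf (w : nat -> bool) : nat -> bool :=
  fun n => nth false (tm_morphism (mkseq w n.+1)) n.

(* The n-th iterate on the letter 0 is a prefix of the word, of length
   2 ^ n > n, so it determines the letter of index n. *)
Definition thue_morse (n : nat) : bool :=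
  nth false (iter n tm_morphism [:: false]) n.

Definition rectangle (w : nat -> bool) (i m n : nat) : 'M[bool]_(m, n) :=
  \matrix_(k < m, l < n) w (i + k + l).

Definition ones (m n : nat) (A : 'M[bool]_(m, n)) : nat :=
  #|[set kl : 'I_m * 'I_n | A kl.1 kl.2 == true]|.

Definition is_max (P : nat -> Prop) (b : nat) : Prop :=
  P b /\ (forall c, P c -> c <= b).

(* The subtraction is that of int, not the truncated one. *)
Definition is_balance (w : nat -> bool) (m n b : nat) : Prop :=
  is_max (fun c => exists i j,
    c = `|ones (rectangle w i m n) - ones (rectangle w j m n)|%N) b.

Lemma nth_tm_morphism s k : k./2 < size s ->
  nth false (tm_morphism s) k = odd k (+) nth false s k./2.
Proof.
elim: s k => [|a s IHs] //= [|[|k]] lt_k /=; try by case: a.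
have -> : nth false (tm_morphism (a :: s)) k.+2 = nth false (tm_morphism s) k.
  by case: a.
by rewrite IHs // negbK.
Qed.

Lemma size_iter_tm n : size (iter n tm_morphism [:: false]) = 2 ^ n.
Proof.
elim: n => //= n IHn; rewrite expnS -IHn.
by elim: (iter n _ _) => //= a s IHs; case: a; rewrite /tm_morphism /= in IHs *; lia.
Qed.

Lemma tm_morphism_infE w k : tm_morphism_inf w k = odd k (+) w k./2.
Proof.
by rewrite /tm_morphism_inf nth_tm_morphism ?size_mkseq ?nth_mkseq //; lia.
Qed.

Lemma nth_iter_tm n m k : k < 2 ^ n -> k < 2 ^ m ->
  nth false (iter n tm_morphism [:: false]) k
  = nth false (iter m tm_morphism [:: false]) k.
Proof.
elim: n m k => [|n IHn] m k.
  rewrite expn0 ltnS leqn0 => /eqP-> _ {k}.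
  elim: m => // m IHm; rewrite iterS nth_tm_morphism ?size_iter_tm ?expn_gt0 //.
case: m => [|m] ltn ltm.
  move: ltm; rewrite expn0 ltnS leqn0 => /eqP->.
  elim: n.+1 => // p IHp; rewrite iterS nth_tm_morphism ?size_iter_tm ?expn_gt0 //.
rewrite !expnS in ltn ltm.
rewrite !iterS !nth_tm_morphism ?size_iter_tm; try lia.
by congr (_ (+) _); apply: IHn; lia.
Qed.

Lemma thue_morse0 : thue_morse 0 = false.
Proof. by []. Qed.

Lemma thue_morse_fixed : tm_morphism_inf thue_morse =1 thue_morse.
Proof.
move=> k; rewrite tm_morphism_infE /thue_morse.
have lt2 j : j < 2 ^ j by apply: ltn_expl.
have := lt2 k; have := lt2 k./2 => H1 H2.
rewrite (@nth_iter_tm k k.+1 k) ?expnS; try lia.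
rewrite iterS nth_tm_morphism ?size_iter_tm; last by lia.
by congr (_ (+) _); apply: nth_iter_tm => //; lia.
Qed.

(* The other fixed point is the complementary word, starting with 1. *)
Lemma thue_morse_unique w :
  w 0 = false -> tm_morphism_inf w =1 w -> w =1 thue_morse.
Proof.
move=> w0 wfix k; elim/ltn_ind: k => [[|k]] IHk; first by rewrite w0.
rewrite -wfix -thue_morse_fixed !tm_morphism_infE IHk //; lia.
Qed.

(* Main.v *)
(* Write s(i) = 1 if t_i = 1 and -1 otherwise, so that 2|A(i,m,n)|_1 - mn is the
   sum of the s(i+k+l).  Since s(2x) = s(x) = -s(2x+1), the function s has the
   antidifference P with P(2x) = 0 and P(2x+1) = s(x), and P in turn has the
   antidifference Q(x) = P(floor(x/2)).  Telescoping twice, the sum is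
   Q(i+m+n) - Q(i+m) - Q(i+n) + Q(i), and |Q| <= 1 gives (a).  For (b), t_{2^p+i}
   is the complement of t_i when i < 2^p.  For (c), by (a) and (b) it is enough
   that the sum does not vanish for all i.  If it does, then differencing twice,
   s(i+m+n) - s(i+m) - s(i+n) + s(i) = 0 for all i; this passes to multiples of m
   and n, so with N = mn one gets s(i+2N) + s(i) = 2s(i+N), hence s is
   N-periodic.  But a period of t can be halved until it is an
   odd number 2h+1, and t_{4h+1} differs from t_{2h}. *)
Require Import Defs.
From mathcomp Require Import all_boot all_order all_algebra.
From mathcomp Require Import zify ring.
From Stdlib Require Import Classical.

Set Implicit Arguments.
Unset Strict Implicit.
Unset Printing Implicit Defensive.

Import Order.TTheory GRing.Theory Num.Theory.
Local Open Scope ring_scope.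

(** Induction on the bound: either [B.+1] is attained and is the maximum, or [B] is already a
    bound. *)
Lemma ex_is_max (P : nat -> Prop) (c B : nat) :
  P c -> (forall x, P x -> x <= B)%N -> exists b, is_max P b.
Proof.
move=> Pc; elim: B => [|B IHB] leB.
  by exists c; split=> // x /leB; lia.
have [PB|nPB] := classic (P B.+1); first by exists B.+1.
apply: IHB => x Px; have := leB x Px; rewrite leq_eqVlt => /orP[/eqP xB|//].
by rewrite xB in Px.
Qed.

Lemma thue_morse_half k : thue_morse k = odd k (+) thue_morse k./2.
Proof. by rewrite -{1}thue_morse_fixed tm_morphism_infE. Qed.

Lemma thue_morse_double k : thue_morse k.*2 = thue_morse k.
Proof. by rewrite thue_morse_half odd_double doubleK. Qed.

Lemma thue_morse_doubleS k : thue_morse k.*2.+1 = ~~ thue_morse k.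
Proof. by rewrite thue_morse_half /= odd_double uphalf_double. Qed.

Lemma thue_morse_add_exp2 p i :
  (i < 2 ^ p)%N -> thue_morse (2 ^ p + i) = ~~ thue_morse i.
Proof.
elim: p i => [|p IHp] i; first by rewrite expn0 ltnS leqn0 => /eqP->.
move=> lti; have E2 : (2 ^ p.+1 = (2 ^ p).*2)%N by rewrite expnS mul2n.
rewrite thue_morse_half (thue_morse_half i) E2 oddD odd_double /=.
have -> : ((2 ^ p).*2 + i)./2 = (2 ^ p + i./2)%N by lia.
by rewrite IHp ?addbN //; lia.
Qed.

Lemma thue_morse_aperiodic N :
  (0 < N)%N -> ~ (forall i, thue_morse (i + N) = thue_morse i).
Proof.
elim/ltn_ind: N => N IHN N_gt0 per.
have := odd_double_half N; case: (odd N) => [defN|defN].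
  have := per (N./2).*2.
  have -> : ((N./2).*2 + N = (N./2).*2.*2.+1)%N by lia.
  by rewrite thue_morse_doubleS; case: (thue_morse _).
apply: (IHN N./2); try lia.
move=> j; rewrite -(thue_morse_double j) -(per j.*2) -thue_morse_double.
by congr thue_morse; lia.
Qed.

Definition tm_sign (i : nat) : int := if thue_morse i then 1 else -1.

(** The antidifference P: signs at [2h] and [2h+1] cancel, so the sum of the signs below [x] is 0 or
    the last sign. *)
Definition tm_sum (x : nat) : int := if odd x then tm_sign x./2 else 0.

Definition tm_sum2 (x : nat) : int := tm_sum x./2.

Lemma tm_sumS x : tm_sum x.+1 = tm_sum x + tm_sign x.
Proof.
rewrite /tm_sum /tm_sign (thue_morse_half x) -addn1 oddD addbT.
case ox: (odd x) => /=; first by case: (thue_morse _).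
have -> : (x + 1)./2 = x./2 by lia.
by rewrite add0r.
Qed.

Lemma tm_sum2S x : tm_sum2 x.+1 = tm_sum2 x + tm_sum x.
Proof.
rewrite /tm_sum2 {3}/tm_sum; case ox: (odd x).
  have -> : (x.+1)./2 = (x./2).+1 by lia.
  exact: tm_sumS.
have -> : (x.+1)./2 = x./2 by lia.
by rewrite addr0.
Qed.

Lemma norm_tm_sum2_le1 x : `|tm_sum2 x| <= 1.
Proof. by rewrite /tm_sum2 /tm_sum /tm_sign; case: (odd _); case: (thue_morse _). Qed.

Definition mixed_diff (f : nat -> int) (m n i : nat) : int :=
  f (i + m + n)%N - f (i + m)%N - f (i + n)%N + f i.

Lemma sum_tm_sign i m n :
  \sum_(k < m) \sum_(l < n) tm_sign (i + k + l) = mixed_diff tm_sum2 m n i.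
Proof.
have row j : \sum_(l < n) tm_sign (j + l) = tm_sum (j + n) - tm_sum j.
  elim: n => [|n IHn]; first by rewrite big_ord0 addn0 subrr.
  by rewrite big_ord_recr /= IHn addnS tm_sumS; ring.
under eq_bigr do rewrite row.
rewrite /mixed_diff; elim: m => [|m IHm]; first by rewrite big_ord0 addn0; ring.
rewrite big_ord_recr /= IHm !(addnS, addSn) !tm_sum2S; ring.
Qed.

Lemma ones_sum w i m n :
  ones (rectangle w i m n) = (\sum_(k < m) \sum_(l < n) w (i + k + l)%N)%N.
Proof.
rewrite /ones -sum1dep_card big_mkcond pair_big /=.
by apply: eq_bigr => -[k l] _ /=; rewrite mxE; case: (w _).
Qed.

Lemma ones_excess i m n :
  2 * (ones (rectangle thue_morse i m n))%:Z - (m * n)%N%:Z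
  = mixed_diff tm_sum2 m n i.
Proof.
rewrite -sum_tm_sign ones_sum.
have signE j : tm_sign j = 2 * (thue_morse j : nat)%:Z - 1.
  by rewrite /tm_sign; case: (thue_morse j).
under [RHS]eq_bigr do under eq_bigr do rewrite signE.
under [RHS]eq_bigr do rewrite sumrB sumr_const card_ord -mulr_sumr.
rewrite sumrB sumr_const card_ord -mulr_sumr -mulrnA -!natz mulnC.
rewrite natr_sum; congr (2 * _ - _).
by apply: eq_bigr => k _; rewrite natr_sum; apply: eq_bigr => l _; rewrite natz.
Qed.

Lemma norm_ones_excess_le4 i m n : `|mixed_diff tm_sum2 m n i| <= 4.
Proof.
rewrite /mixed_diff.
have := norm_tm_sum2_le1 (i + m + n); have := norm_tm_sum2_le1 (i + m).
have := norm_tm_sum2_le1 (i + n); have := norm_tm_sum2_le1 i.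
lia.
Qed.

Lemma ones_excess_opp m n i :
  exists j, mixed_diff tm_sum2 m n j = - mixed_diff tm_sum2 m n i.
Proof.
(* The exponent makes the power of 2 exceed every index [i + k + l] in the rectangle, so the shift
   flips all its letters. *)
exists (2 ^ (i + m + n) + i)%N; rewrite -!sum_tm_sign -sumrN.
apply: eq_bigr => k _; rewrite -sumrN; apply: eq_bigr => l _.
rewrite /tm_sign -!addnA thue_morse_add_exp2; first by case: (thue_morse _).
apply: leq_ltn_trans (ltn_expl _ (ltnSn 1)).
by have := ltn_ord k; have := ltn_ord l; lia.
Qed.

Lemma mixed_diffC f m n : mixed_diff f m n =1 mixed_diff f n m.
Proof. by move=> i; rewrite /mixed_diff addnAC; ring. Qed.

(** A difference of step [k * m] is the sum of those of step [m] at [i], [i + m], and so on. *)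
Lemma mixed_diff_mull0 f m n k :
  mixed_diff f m n =1 (fun=> 0) -> mixed_diff f (k * m) n =1 (fun=> 0).
Proof.
move=> f0; elim: k => [|k IHk] i; first by rewrite /mixed_diff addn0; ring.
have := f0 (i + k * m)%N; have := IHk i; rewrite /mixed_diff mulSn.
by rewrite [(m + _)%N]addnC !addnA; lia.
Qed.

(** The mixed difference of [g] at [i] is that of [f] at [i.+1] minus that of [f] at [i]. *)
Lemma mixed_diff_antidiff0 f g m n : (forall i, f i.+1 = f i + g i) ->
  mixed_diff f m n =1 (fun=> 0) -> mixed_diff g m n =1 (fun=> 0).
Proof.
move=> fS f0 i; have := f0 i; have := f0 i.+1.
by rewrite /mixed_diff !addSn !fS; lia.
Qed.

Lemma ones_excess_neq0 m n : (0 < m)%N -> (0 < n)%N ->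
  exists i, mixed_diff tm_sum2 m n i != 0.
Proof.
move=> m_gt0 n_gt0; apply: NNPP => no_i.
have D0 : mixed_diff tm_sign m n =1 (fun=> 0).
  apply: (mixed_diff_antidiff0 tm_sumS); apply: (mixed_diff_antidiff0 tm_sum2S).
  by move=> i; apply/eqP/negP => /negP i0; apply: no_i; exists i.
have DN : mixed_diff tm_sign (n * m) (m * n) =1 (fun=> 0).
  apply: mixed_diff_mull0 => i; rewrite mixed_diffC.
  by apply: mixed_diff_mull0 => j; rewrite mixed_diffC.
apply: (@thue_morse_aperiodic (m * n)); first by rewrite muln_gt0 m_gt0.
move=> i; have := DN i; rewrite /mixed_diff mulnC /tm_sign.
(* The sign at [i + N] is the mean of those at [i] and [i + 2N]; as all are 1 or -1, they agree. *)
by do 3 case: (thue_morse _).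
Qed.

Theorem theorem11 :
  (forall i m n : nat, (0 < m)%N -> (0 < n)%N ->
     (`|2 * (ones (rectangle thue_morse i m n))%:Z - (m * n)%N%:Z| <= 4%:Z)%R)
  /\
  (forall (m n : nat) (c : int), (0 < m)%N -> (0 < n)%N ->
     (exists i : nat,
        (2 * (ones (rectangle thue_morse i m n))%:Z - (m * n)%N%:Z = c)%R) ->
     exists j : nat,
        (2 * (ones (rectangle thue_morse j m n))%:Z - (m * n)%N%:Z = - c)%R)
  /\
  (forall m n : nat, (0 < m)%N -> (0 < n)%N ->
     exists b : nat, is_balance thue_morse m n b /\
       (b = 1%N \/ b = 2%N \/ b = 3%N \/ b = 4%N)).
Proof.
split; last split=> [m n c _ _ [i <-]|m n m_gt0 n_gt0].
- by move=> i m n _ _; rewrite ones_excess norm_ones_excess_le4.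
- by have [j Dj] := ones_excess_opp m n i; exists j; rewrite !ones_excess.
have [i Di0] := ones_excess_neq0 m_gt0 n_gt0.
have [j Dj] := ones_excess_opp m n i.
(* Equal positions give the value 0. Two excesses within 4 of 0 differ by at most 8, which is twice
   the bound on the counts. *)
have [|x [x1 [x2 ->]]|b [Pb maxb]] := @ex_is_max (fun c => exists i j, c =
  `|ones (rectangle thue_morse i m n) - ones (rectangle thue_morse j m n)|%N)
  0%N 4.
- by exists 0%N, 0%N; lia.
- have := norm_ones_excess_le4 x1 m n; have := norm_ones_excess_le4 x2 m n.
  by rewrite -!ones_excess; lia.
exists b; split=> //.
(* The excesses at [i] and [j] are opposite and nonzero, so the counts differ. *)
have b_gt0 : (0 < b)%N.
  have := maxb _ (ex_intro _ i (ex_intro _ j erefl)).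
  by move: Di0 Dj; rewrite -!ones_excess; lia.
case: Pb => x1 [x2 defb].
have := norm_ones_excess_le4 x1 m n; have := norm_ones_excess_le4 x2 m n.
by rewrite -!ones_excess; lia.
Qed.
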